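(* Suppose the following hold. (1) For every $v_i\in\mathcal V$, the function $f_i:\mathbb R^d\to\mathbb R$ is convex and $\operatorname{argmin} f_i$ is non-empty and bounded. (2) There is $L>0$ such that $\|g\|_2\le L$ for all $v_i\in\mathcal V$, all $x\in\mathbb R^d$ and all $g\in\partial f_i(x)$. (3) The step-sizes satisfy $\lim_{k\to\infty}\eta[k]=0$, $\eta[k+1]<\eta[k]$ for all $k$, and $\sum_{k=0}^\infty\eta[k]=\infty$. (4) The graph $\mathcal G$ is $((2d+1)F+1)$-robust and the set $\mathcal A$ of Byzantine nodes is an $F$-local set. If the states of the regular nodes are updated using the Distance-MinMax Filtering Dynamics, then for all $v_i\in\mathcal R$, $$\limsup_{k\to\infty}\|x_i[k]-\hat x\|_2\le R^*,$$ regardless of the actions of the ($F$-local) set of Byzantine nodes, where $$R^*=\inf_{\epsilon>0}\Big\{\max_{v_i\in\mathcal R}\max\{\tilde R_i\sec\theta_i(\epsilon),\ \tilde R_i+\delta_i(\epsilon)\}\Big\}.$$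
   Context: Network. $\mathcal G=(\mathcal V,\mathcal E)$ is a finite directed graph with $\mathcal V=\{v_1,\dots,v_N\}$; $(v_j,v_i)\in\mathcal E$ means $v_i$ can receive information from $v_j$, and $\mathcal N_i^-=\{v_j:(v_j,v_i)\in\mathcal E\}$. $\mathcal V$ is partitioned into Byzantine nodes $\mathcal A$ and regular nodes $\mathcal R=\mathcal V\setminus\mathcal A$ (non-empty). A Byzantine node may send arbitrary, possibly different, vectors in $\mathbb R^d$ to its different out-neighbors at each time-step. For $F\in\mathbb N$, $\mathcal A$ is an $F$-local set if $|\mathcal N_i^-\cap\mathcal A|\le F$ for all $v_i\in\mathcal R$. A set $\mathcal S\subseteq\mathcal V$ is $r$-reachable if some $v_i\in\mathcal S$ has $|\mathcal N_i^-\setminus\mathcal S|\ge r$. $\mathcal G$ is $r$-robust if for every pair of disjoint non-empty subsets $\mathcal S_1,\mathcal S_2\subset\mathcal V$, at least one of them is $r$-reachable. Algorithm (Distance-MinMax Filtering Dynamics, parameter $F$). Each regular $v_i$ computes a minimizer $x_i^*$ of its function $f_i:\mathbb R^d\to\mathbb R$. The nodes run a resilient consensus procedure on the $x_i^*$ producing a vector $\hat x\in\mathbb R^d$ (the auxiliary point), which is fixed and common to all regular nodes; no other property of $\hat x$ is used here. Each regular $v_i$ sets $x_i[0]=x_i^*$. At each time $k=0,1,2,\dots$, each $v_i\in\mathcal R$ does the following, where $x_j[k]$ denotes the vector that $v_i$ receives from $v_j\in\mathcal N_i^-$ (the true state if $v_j\in\mathcal R$; arbitrary, and possibly depending on the receiver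 $v_i$, if $v_j\in\mathcal A$): (a) $\mathcal S_i[k]$ is the collection (indexed by nodes) of the $x_j[k]$, $v_j\in\mathcal N_i^-$, together with $x_i[k]$. (b) Distance filter: among the in-neighbors' states (never its own state $x_i[k]$), remove the $F$ states with the highest values of $\|x_j[k]-\hat x\|_2$ (ties broken arbitrarily; all are removed if there are fewer than $F$). The remaining collection, including $x_i[k]$, is $\mathcal S_i^{\rm dist}[k]$. (c) Min-max filter: from $\mathcal S_i^{\rm dist}[k]$ remove every state $x_j[k]$ other than $x_i[k]$ for which there is a component $p\in\{1,\dots,d\}$ such that $[x_j[k]]_p$ is among the $F$ highest or the $F$ lowest values of the $p$-th components of the states in $\mathcal S_i^{\rm dist}[k]$ other than $x_i[k]$ (ties broken arbitrarily, so at most $2F$ states are removed per component). The remaining collection is $\mathcal S_i^{\rm mm}[k]$. (d) $z_i[k]$ is the arithmetic mean of the states in $\mathcal S_i^{\rm mm}[k]$. (e) $x_i[k+1]=z_i[k]-\eta[k]g_i[k]$ with $g_i[k]\in\partial f_i(z_i[k])$, where $\eta[k]$ is the step-size and $\partial f_i$ the subdifferential. Quantities in $R^*$. $\mathcal B(x_0,r)$ is the closed Euclidean ball; $\angle(u,v)=\arccos\big(\langle u,v\rangle/(\|u\|_2\|v\|_2)\big)$. For $v_i\in\mathcal R$: $\tilde R_i=\|x_i^*-\hat x\|_2$. For $\epsilon>0$: $\mathcal C_i(\epsilon)=\{x:f_i(x)\le f_i(x_i^* )+\epsilon\}$; $\delta_i(\epsilon)\in(0,\infty)$ is a number with $\mathcal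 C_i(\epsilon)\subseteq\mathcal B(x_i^*,\delta_i(\epsilon))$; and $\theta_i(\epsilon)\in[0,\pi/2)$ is a number with $\angle(-g,\,x_i^*-x)\le\theta_i(\epsilon)$ for all $x\notin\mathcal C_i(\epsilon)$ and $g\in\partial f_i(x)$. (Such numbers exist under (1) and (2); a choice is fixed for every $i$ and $\epsilon$.) *)

(* Defs.v *)
From HB Require Import structures.
From mathcomp Require Import all_boot all_order all_algebra.
From mathcomp Require Import all_classical all_reals all_analysis.

Set Implicit Arguments.
Unset Strict Implicit.
Unset Printing Implicit Defensive.

Import Order.TTheory GRing.Theory Num.Theory.
Import numFieldNormedType.Exports.

Local Open Scope ring_scope.

Section Euclidean.
Context {R : realType} {d : nat}.
Implicit Types (u v x g : 'rV[R]_d) (h : 'rV[R]_d -> R).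

Definition dot u v : R := \sum_(p < d) u 0 p * v 0 p.

(* The library norm `|u| on row vectors is the maximum norm. *)
Definition enorm u : R := Num.sqrt (dot u u).

Definition eball x (r : R) : set 'rV[R]_d :=
  [set y | enorm (y - x) <= r]%classic.

Definition angle u v : R := acos (dot u v / (enorm u * enorm v)).

Definition argmin h : set 'rV[R]_d := [set x | forall y, h x <= h y]%classic.

Definition subdiff h x : set 'rV[R]_d :=
  [set g | forall y, h x + dot g (y - x) <= h y]%classic.

(* The set C_i(eps), for h = f_i and xs = x_i^* *)
Definition sublevel h (xs : 'rV[R]_d) (eps : R) : set 'rV[R]_d :=
  [set x | h x <= h xs + eps]%classic.

End Euclidean.

Definition sec {R : realType} (t : R) : R := (cos t)^-1.

Section Graph.
Context {V : finType}.
(* [E j i] is the edge (v_j, v_i): node i can receive from node j. *)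
Implicit Types (E : rel V) (A S : {set V}) (i : V).

Definition inN E i : {set V} := [set j | E j i]%SET.

Definition F_local E (F : nat) A : Prop :=
  forall i, i \notin A -> (#|inN E i :&: A| <= F)%N.

Definition reachable E (r : nat) S : Prop :=
  exists2 i, i \in S & (r <= #|inN E i :\: S|)%N.

Definition robust E (r : nat) : Prop :=
  forall S1 S2 : {set V}, S1 != finset.set0 -> S2 != finset.set0 ->
    [disjoint S1 & S2] -> reachable E r S1 \/ reachable E r S2.

End Graph.

Section Dynamics.
Context {R : realType} {d : nat} {V : finType}.
(* Collections of states are indexed by nodes, so that a collection is given by
   a set of nodes together with [y : V -> 'rV[R]_d], where [y j] is the vector
   that a fixed node i gets from j, and [y i] is its own state. *)
Implicit Types (y : V -> 'rV[R]_d) (i : V) (S T B : {set V}) (F : nat).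

(* [T] is a possible choice, with ties broken arbitrarily, of [n] elements of
   [B] with the highest values of [w]; it is all of [B] if [B] has fewer than
   [n] elements. *)
Definition highest (w : V -> R) (n : nat) B T : Prop :=
  [/\ T \subset B, #|T| = minn n #|B| &
      forall j l, j \in T -> l \in B :\: T -> w l <= w j].

Definition lowest (w : V -> R) (n : nat) B T : Prop :=
  highest (fun j => - w j) n B T.

(* Excluding i from [inN E i] only matters if E has a self-loop at i: a node
   never removes its own state. *)
Definition dist_filter (E : rel V) F (xhat : 'rV[R]_d) y i Sdist : Prop :=
  exists2 T, highest (fun j => enorm (y j - xhat)) F (inN E i :\ i) T &
             Sdist = (i |: inN E i) :\: T.

Definition minmax_filter F y i Sdist Smm : Prop :=
  exists hi lo : 'I_d -> {set V},
    [/\ forall p, highest (fun j => y j 0 p) F (Sdist :\ i) (hi p),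
        forall p, lowest (fun j => y j 0 p) F (Sdist :\ i) (lo p) &
        Smm = Sdist :\: (\bigcup_(p < d) (hi p :|: lo p))%SET].

Definition mean y S : 'rV[R]_d := #|S|%:R^-1 *: \sum_(j in S) y j.

Definition dmm_update (E : rel V) F (h : 'rV[R]_d -> R) (xhat : 'rV[R]_d)
    (step : R) y i (x' : 'rV[R]_d) : Prop :=
  exists (Sdist Smm : {set V}) (g : 'rV[R]_d),
    [/\ dist_filter E F xhat y i Sdist,
        minmax_filter F y i Sdist Smm,
        subdiff h (mean y Smm) g &
        x' = mean y Smm - step *: g].

(* [byz k i j] is the arbitrary vector that the Byzantine node j sends to i at
   time k. *)
Definition received (A : {set V}) (x : nat -> V -> 'rV[R]_d)
    (byz : nat -> V -> V -> 'rV[R]_d) (k : nat) i : V -> 'rV[R]_d :=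
  fun j => if j \in A then byz k i j else x k j.

(* The values [x k i] at Byzantine nodes i are unconstrained and never used. *)
Definition dmm_dynamics (E : rel V) F (A : {set V}) (f : V -> 'rV[R]_d -> R)
    (xhat : 'rV[R]_d) (xstar : V -> 'rV[R]_d) (eta : nat -> R)
    (byz : nat -> V -> V -> 'rV[R]_d) (x : nat -> V -> 'rV[R]_d) : Prop :=
  (forall i, i \notin A -> x 0%N i = xstar i) /\
  (forall k i, i \notin A ->
     dmm_update E F (f i) xhat (eta k) (received A x byz k i) i (x k.+1 i)).

Definition Rtilde (xhat : 'rV[R]_d) (xstar : V -> 'rV[R]_d) i : R :=
  enorm (xstar i - xhat).

(* Extended reals are used so that neither the maximum nor the infimum needs a
   conventional value. *)
Definition Rstar (A : {set V}) (xhat : 'rV[R]_d) (xstar : V -> 'rV[R]_d)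
    (delta theta : V -> R -> R) : \bar R :=
  ereal_inf
    [set \big[maxe/-oo%E]_(i | i \notin A)
           (Num.max (Rtilde xhat xstar i * sec (theta i eps))
                    (Rtilde xhat xstar i + delta i eps))%:E
    | eps in [set eps : R | 0 < eps]]%classic.

End Dynamics.

(* Main.v *)
Require Import Defs.
From HB Require Import structures.
From mathcomp Require Import all_boot all_order all_algebra.
From mathcomp Require Import all_classical all_reals all_analysis.
From mathcomp Require Import ring lra.
Import Order.TTheory GRing.Theory Num.Theory.
Import numFieldNormedType.Exports.
Local Open Scope classical_set_scope.
Local Open Scope ring_scope.

(** Put D k = max_(i regular) |x_i[k] - xhat|. By F-locality a state that survives
    the distance filter is no farther from xhat than some regular state, and a
    node never discards its own state; hence |z_i[k] - xhat| <= D k, whatever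
    the min-max filter does and without using robustness. Fix eps, let M be the
    maximum in R*, and let s > 0. If |z_i[k] - xhat| >= M + s/2, then the bound on
    the angle at z_i[k] between -g and x_i^* - z_i[k], together with
    |x_i^* - xhat| sec theta_i < M + s/2, gives <g, z_i[k] - xhat> >= c for a
    constant c > 0, so once eta[k] L^2 <= c the step lowers the squared distance
    by at least eta[k] c; otherwise the step ends within M + s as soon as
    eta[k] L <= s/2. Since the step-sizes sum to infinity, D k <= M + s
    eventually. *)

(** * Euclidean geometry and the uniform descent inequality *)

Section EuclideanTheory.
Set Implicit Arguments.
Unset Strict Implicit.
Context {R : realType} {d : nat}.
Implicit Types (u v w e g z : 'rV[R]_d) (a r : R).

Lemma dotC u v : dot u v = dot v u.
Proof. by apply: eq_bigr => p _; rewrite mulrC. Qed.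

Lemma dotDl u v w : dot (u + v) w = dot u w + dot v w.
Proof. by rewrite /dot -big_split; apply: eq_bigr => p _; rewrite mxE mulrDl. Qed.

Lemma dotZl a u v : dot (a *: u) v = a * dot u v.
Proof. by rewrite /dot mulr_sumr; apply: eq_bigr => p _; rewrite mxE mulrA. Qed.

Lemma dotNl u v : dot (- u) v = - dot u v.
Proof. by rewrite -scaleN1r dotZl mulN1r. Qed.

Lemma dotDr u v w : dot w (u + v) = dot w u + dot w v.
Proof. by rewrite dotC dotDl !(dotC w). Qed.

Lemma dotZr a u v : dot v (a *: u) = a * dot v u.
Proof. by rewrite dotC dotZl dotC. Qed.

Lemma dotNr u v : dot v (- u) = - dot v u.
Proof. by rewrite dotC dotNl dotC. Qed.

Definition dotE := (dotDl, dotDr, dotNl, dotNr, dotZl, dotZr).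

Lemma dot_ge0 u : 0 <= dot u u.
Proof. by apply: sumr_ge0 => p _; rewrite -expr2 sqr_ge0. Qed.

Lemma enorm_ge0 u : 0 <= enorm u.
Proof. exact: sqrtr_ge0. Qed.

Lemma enorm_sqr u : enorm u ^+ 2 = dot u u.
Proof. by rewrite sqr_sqrtr ?dot_ge0. Qed.

Lemma enorm0 : enorm (0 : 'rV[R]_d) = 0.
Proof. by rewrite /enorm /dot big1 ?sqrtr0// => p _; rewrite mxE mul0r. Qed.

Lemma enormZ a u : enorm (a *: u) = `|a| * enorm u.
Proof. by rewrite /enorm !dotE mulrA -expr2 sqrtrM ?sqr_ge0// sqrtr_sqr. Qed.

Lemma enormN u : enorm (- u) = enorm u.
Proof. by rewrite -scaleN1r enormZ normrN1 mul1r. Qed.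

Lemma cauchy_schwarz_sqr u v : dot u v ^+ 2 <= dot u u * dot v v.
Proof.
have [v0|v0] := eqVneq (dot v v) 0; last first.
  have vv : 0 < dot v v by rewrite lt_def v0 dot_ge0.
  have := dot_ge0 (dot v v *: u - dot u v *: v).
  rewrite !dotE (dotC v u) => h.
  have {h} : 0 <= dot v v * (dot u u * dot v v - dot u v ^+ 2) by nra.
  by rewrite pmulr_rge0// subr_ge0.
have [->|uv0] := eqVneq (dot u v) 0; first by rewrite v0 mulr0 expr0n.
(* With |v| = 0 and <u, v> nonzero, this multiple of v would give the vector the squared norm -
   |u|^2 - 2, which is negative. *)
have := dot_ge0 (u - ((dot u u + 1) / dot u v) *: v).
rewrite !dotE (dotC v u) v0 divfK//.
by have := dot_ge0 u; lra.
Qed.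

Lemma cauchy_schwarz u v : `|dot u v| <= enorm u * enorm v.
Proof.
rewrite -ler_sqr ?nnegrE ?mulr_ge0 ?enorm_ge0// real_normK ?num_real//.
by rewrite exprMn !enorm_sqr cauchy_schwarz_sqr.
Qed.

Lemma enormD u v : enorm (u + v) <= enorm u + enorm v.
Proof.
rewrite -ler_sqr ?nnegrE ?addr_ge0 ?enorm_ge0// sqrrD !enorm_sqr !dotE.
have := le_trans (ler_norm _) (cauchy_schwarz u v).
rewrite (dotC v u); lra.
Qed.

Lemma enorm_sum (I : finType) (S : {set I}) (y : I -> 'rV[R]_d) :
  enorm (\sum_(j in S) y j) <= \sum_(j in S) enorm (y j).
Proof.
apply: (big_ind2 (fun u a => enorm u <= a)) => [|u a v b ua vb|//].
  by rewrite enorm0.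
exact: le_trans (enormD u v) (lerD ua vb).
Qed.

(** Balls are convex; the member i of S keeps [#|S|] invertible. *)
Lemma mean_eball (I : finType) (S : {set I}) (y : I -> 'rV[R]_d) c r i :
  i \in S -> (forall j, j \in S -> eball c r (y j)) -> eball c r (mean y S).
Proof.
move=> iS yr; have S0 : (0 : R) < #|S|%:R.
  by rewrite ltr0n card_gt0; apply/finset.set0Pn; exists i.
rewrite /eball/= /mean.
have -> : #|S|%:R^-1 *: \sum_(j in S) y j - c
    = #|S|%:R^-1 *: \sum_(j in S) (y j - c).
  rewrite big_split/= scalerDr sumr_const -[- c *+ _]scaler_nat scalerA.
  by rewrite mulVf ?gt_eqF// scale1r.
rewrite enormZ gtr0_norm ?invr_gt0// ler_pdivrMl//.
apply: le_trans (enorm_sum _ _) _; rewrite mulr_natl -sumr_const.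
exact: ler_sum.
Qed.

Lemma dot_le_angle g u t : 0 <= t < pi / 2 -> angle g u <= t ->
  cos t * (enorm g * enorm u) <= dot g u.
Proof.
move=> /andP[t0 tpi] gut.
have cs := cauchy_schwarz g u.
(* For a zero vector [angle] is [acos 0] by the convention on division; Cauchy-Schwarz then settles
   the claim directly. *)
have [gu0|gu0] := eqVneq (enorm g * enorm u) 0.
  by move: cs; rewrite gu0 mulr0 ler_norml oppr0 => /andP[].
have gu : 0 < enorm g * enorm u.
  by rewrite lt_def gu0 mulr_ge0 ?enorm_ge0.
have q1 : -1 <= dot g u / (enorm g * enorm u) <= 1.
  by rewrite -ler_norml normf_div (gtr0_norm gu) ler_pdivrMr// mul1r.
have pi0 : 0 < pi :> R := pi_gt0 R.
rewrite -ler_pdivlMr//; have [_ <-] := acos_def q1; rewrite leNgt ltr_cos -?leNgt//.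
- by rewrite in_itv/= t0/=; lra.
- by rewrite in_itv/= acos_ge0// acos_lepi.
Qed.

(* The angle at z between the directions of xs and xhat has sine at most
   r / |w|, so in terms of angles this is cos (t + asin (r / |w|)) <= <g, w>/|w|;
   splitting g and w along u and its complement avoids adding angles. *)
Lemma dot_shift_ge g u w r t :
  dot g g = 1 -> 0 < enorm u -> 0 <= t < pi / 2 ->
  cos t * enorm u <= dot g u -> enorm (w - u) <= r -> r < enorm w ->
  cos t * Num.sqrt (enorm w ^+ 2 - r ^+ 2) - sin t * r <= dot g w.
Proof.
move=> g1 u0 /andP[t0 tpi] gu er rw.
have e0 := enorm_ge0 (w - u); have w0 := enorm_ge0 w.
have r0 : 0 <= r by exact: le_trans er.
have pi0 : 0 < pi :> R := pi_gt0 R.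
have C0 : 0 < cos t by apply: cos_gt0_pihalf; rewrite tpi andbT; lra.
have S0 : 0 <= sin t by apply: sin_ge0_pi; rewrite t0/=; lra.
have CS := cos2Dsin2 t.
have [b ub b1] : exists2 b, u = enorm u *: b & dot b b = 1.
  exists ((enorm u)^-1 *: u); first by rewrite scalerA mulfV ?gt_eqF// scale1r.
  by rewrite !dotE -enorm_sqr expr2 mulKf ?mulVf ?gt_eqF.
set m := dot b w; set p := dot g b.
have Cp : cos t <= p by move: gu; rewrite ub dotE -ub mulrC ler_pM2l.
have p1 : p ^+ 2 <= 1 by have := cauchy_schwarz_sqr g b; rewrite g1 b1 mul1r.
have er2 : enorm (w - u) ^+ 2 <= r ^+ 2 by nra.
(* As u is a multiple of b, the vectors w and w - u have the same part orthogonal to b, so its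
   length is at most r. *)
have q : dot w w - m ^+ 2 <= r ^+ 2.
  apply: le_trans er2; rewrite enorm_sqr {1 2}ub.
  rewrite !dotE b1 (dotC w b) -/m.
  by have := sqr_ge0 (enorm u - m); nra.
(* <u, w> = |w|^2 - <w - u, w> >= |w| (|w| - r) > 0. *)
have m0 : 0 < m.
  rewrite -(pmulr_rgt0 _ u0) /m -dotZl -ub.
  have -> : dot u w = enorm w ^+ 2 - dot (w - u) w.
    by rewrite enorm_sqr !dotE; ring.
  have := le_trans (ler_norm _) (cauchy_schwarz (w - u) w).
  nra.
(* The parts of g and w orthogonal to b have lengths at most sin t and r, so <g, w> differs from p m
   by at most their product. *)
have := cauchy_schwarz_sqr (g - p *: b) (w - m *: b).
rewrite !dotE b1 g1 (dotC b g) (dotC w b) -/m -/p => cs.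
have {}cs : (dot g w - p * m) ^+ 2 <= (1 - p ^+ 2) * (dot w w - m ^+ 2).
  by move: cs; congr (_ <= _); ring.
have w2m : m ^+ 2 <= dot w w.
  by have := cauchy_schwarz_sqr b w; rewrite b1 mul1r.
have {}cs : (dot g w - p * m) ^+ 2 <= (sin t * r) ^+ 2.
  apply: le_trans cs _; rewrite exprMn; apply: ler_pM => //; nra.
have sm : Num.sqrt (enorm w ^+ 2 - r ^+ 2) <= m.
  rewrite -ler_sqr ?nnegrE ?sqrtr_ge0 ?(ltW m0)//.
  rewrite sqr_sqrtr; last by rewrite subr_ge0 ler_sqr ?nnegrE// ltW.
  rewrite enorm_sqr; lra.
have q0 := sqrtr_ge0 (enorm w ^+ 2 - r ^+ 2).
have Sr0 : 0 <= sin t * r by rewrite mulr_ge0.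
have : p * m - dot g w <= sin t * r.
  rewrite -[leRHS]ger0_norm// -sqrtr_sqr -[leLHS]opprB.
  apply: le_trans (ler_wsqrtr cs).
  by rewrite sqrtr_sqr -normrN ler_norm.
nra.
Qed.

(** [dot_shift_ge], applied to the normalised [- g] with u = xs - z and w = xhat - z, controls the
    direction of g. For a constant independent of z, |g| must also be bounded below: outside the
    sublevel set the subgradient inequality at xs gives eps <= <-g, u> <= |g| |u|. *)
Lemma subgradient_descent (h : 'rV[R]_d -> R) xs xhat (eps r t rho : R) :
  0 < eps -> sublevel h xs eps `<=` eball xs r -> 0 < r -> 0 <= t < pi / 2 ->
  (forall z g, ~ sublevel h xs eps z -> subdiff h z g ->
     angle (- g) (xs - z) <= t) ->
  enorm (xs - xhat) * sec t < rho -> enorm (xs - xhat) + r < rho ->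
  exists2 c, 0 < c & forall z g, subdiff h z g -> rho <= enorm (z - xhat) ->
    c <= dot g (z - xhat).
Proof.
move=> eps0 subr r0 tb angt; move ea : (enorm (xs - xhat)) => a aC ar.
have a0 : 0 <= a by rewrite -ea enorm_ge0.
have pi0 : 0 < pi :> R := pi_gt0 R.
have C0 : 0 < cos t.
  by apply: cos_gt0_pihalf; move: tb => /andP[? ->]; rewrite andbT; lra.
have S0 : 0 <= sin t.
  by apply: sin_ge0_pi; move: tb => /andP[-> ?]/=; lra.
have CS := cos2Dsin2 t.
have {}aC : a < rho * cos t by rewrite -ltr_pdivrMr.
have rho0 : 0 < rho by lra.
(* The bound of [dot_shift_ge] at |w| = rho; comparing squares, it is positive because a < rho cos
   t. *)
pose c0 := cos t * Num.sqrt (rho ^+ 2 - a ^+ 2) - sin t * a.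
have c00 : 0 < c0.
  have Ca : a ^+ 2 < (rho * cos t) ^+ 2.
    by rewrite ltr_sqr ?nnegrE ?mulr_ge0 ?(ltW C0) ?(ltW rho0).
  rewrite subr_gt0 -ltr_sqr ?nnegrE ?mulr_ge0 ?sqrtr_ge0 ?(ltW C0)//.
  rewrite !exprMn sqr_sqrtr.
    have -> : sin t ^+ 2 = 1 - cos t ^+ 2 by lra.
    by move: Ca; rewrite exprMn; lra.
  by rewrite subr_ge0 ler_sqr ?nnegrE ?(ltW rho0)//; lra.
(* It will be shown that <-g, w> >= |g| (|w| / rho) c0 and that |g| |w| >= eps / 2. *)
exists (eps * c0 / (2 * rho)).
  by rewrite divr_gt0 ?mulr_gt0.
move=> z g hg; rewrite -opprB enormN => rhoz.
set w := xhat - z in rhoz *; set u := xs - z.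
have ewu : enorm (w - u) = a.
  rewrite -ea -enormN; congr enorm; rewrite /w /u opprB; apply/rowP => j.
  by rewrite !mxE; ring.
have u_le : enorm u <= enorm w + a.
  have -> : u = w - (w - u) by rewrite opprB addrC subrK.
  by rewrite (le_trans (enormD _ _))// enormN ewu.
have u_ge : r < enorm u.
  have : enorm w <= enorm u + a.
    by rewrite -{1}(subrK u w) addrC (le_trans (enormD _ _))// ewu.
  lra.
have zsub : ~ sublevel h xs eps z.
  by move=> /subr; rewrite /eball/= -opprB enormN -/u leNgt u_ge.
have gu_eps : eps <= dot (- g) u.
  have := hg xs; move: zsub; rewrite /sublevel/= => /negP; rewrite -ltNge.
  by rewrite -/u dotNl; lra.
have gu_cos : cos t * (enorm (- g) * enorm u) <= dot (- g) u.
  by apply: dot_le_angle => //; exact: angt.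
have gu_CS := le_trans (ler_norm _) (cauchy_schwarz (- g) u).
have u0 : 0 < enorm u by lra.
have g0 : 0 < enorm (- g) by rewrite -(pmulr_lgt0 _ u0); lra.
set n := enorm (- g) in g0 gu_cos gu_CS *.
have gg : dot (n^-1 *: - g) (n^-1 *: - g) = 1.
  by rewrite !dotZl !dotZr -enorm_sqr -/n expr2 mulKf ?mulVf ?gt_eqF.
have gu1 : cos t * enorm u <= dot (n^-1 *: - g) u.
  by rewrite dotZl ler_pdivlMl// mulrCA.
have wua : enorm (w - u) <= a by rewrite ewu.
have arho : a < rho by lra.
have aw : a < enorm w by lra.
have := dot_shift_ge gg u0 tb gu1 wua aw.
rewrite dotZl dotNl dotNr ler_pdivlMl// => gw.
move: (enorm w) rhoz u_le aw gw => W rhoz u_le aw gw.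
(* sqrt (W^2 - a^2) / W is nondecreasing in W, whence the bound at |w| = W is at least (W / rho)
   c0. *)
have sq : W * Num.sqrt (rho ^+ 2 - a ^+ 2) <= rho * Num.sqrt (W ^+ 2 - a ^+ 2).
  have W0 : 0 < W by lra.
  have sq0 x : a < x -> 0 <= x ^+ 2 - a ^+ 2.
    by move=> ax; rewrite subr_ge0 ler_sqr ?nnegrE; lra.
  rewrite -ler_sqr ?nnegrE ?mulr_ge0 ?sqrtr_ge0 ?(ltW W0) ?(ltW rho0)//.
  rewrite !exprMn !sqr_sqrtr ?sq0//.
  have : rho ^+ 2 * a ^+ 2 <= W ^+ 2 * a ^+ 2.
    by rewrite ler_wpM2r ?sqr_ge0// ler_sqr ?nnegrE ?(ltW W0) ?(ltW rho0).
  lra.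
rewrite ler_pdivrMr ?mulr_gt0//.
have Wc0 : W * c0 <=
    rho * (cos t * Num.sqrt (W ^+ 2 - a ^+ 2) - sin t * a).
  have := ler_wpM2l (ltW C0) sq.
  have : sin t * a * rho <= sin t * a * W by rewrite ler_wpM2l ?mulr_ge0.
  rewrite /c0; lra.
have h1 := ler_wpM2l (ltW g0) Wc0.
have h2 := ler_wpM2l (ltW rho0) gw.
have h3 : eps <= n * (2 * W).
  apply: le_trans gu_eps (le_trans gu_CS _).
  by rewrite ler_wpM2l ?(ltW g0)//; lra.
have := ler_wpM2r (ltW c00) h3.
lra.
Qed.

End EuclideanTheory.

(** * Effect of the two filters on balls around the auxiliary point *)

Section Filters.
Context {R : realType} {d : nat} {V : finType}.
Context (E : rel V) (A : {set V}) (F : nat) (hlocal : F_local E F A).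
Implicit Types (y : V -> 'rV[R]_d) (xhat : 'rV[R]_d) (i : V) (S : {set V}).
Set Implicit Arguments.
Unset Strict Implicit.

Lemma dist_filter_self xhat y i S : dist_filter E F xhat y i S -> i \in S.
Proof.
move=> [T [/fintype.subsetP TB _ _] ->]; rewrite finset.in_setD finset.setU11 andbT.
by apply/negP => /TB; rewrite !inE eqxx.
Qed.

(* If a Byzantine state survives, then F in-neighbours farther from xhat were
   removed; by F-locality one of them is regular. *)
Lemma dist_filter_eball xhat y i S r : i \notin A ->
  dist_filter E F xhat y i S ->
  (forall j, j \notin A -> eball xhat r (y j)) ->
  forall j, j \in S -> eball xhat r (y j).
Proof.
move=> iA [T [TB cT Tmax] ->] yr j; rewrite !inE => /andP[jT jB].
have [jA|/yr//] := boolP (j \in A).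
have ji : j != i by apply: contraNneq iA => <-.
have {}jB : j \in (inN E i :\ i) by move: jB; rewrite !inE (negPf ji).
have jTN : j |: T \subset inN E i.
  rewrite finset.subUset finset.sub1set.
  rewrite (fintype.subset_trans TB (finset.subsetDl _ _)).
  by rewrite (fintype.subsetP (finset.subsetDl _ _) _ jB).
(* With fewer than F candidates all would be removed, j among them. *)
have FT : #|T| = F.
  rewrite cT; apply/minn_idPl; rewrite leqNgt; apply/negP => BF.
  have /eqP TBe : T == inN E i :\ i.
    by rewrite eqEcard TB cT leq_min leqnn andbT ltnW.
  by rewrite TBe jB in jT.
have [l lT lA] : exists2 l, l \in T & l \notin A.
  apply/fintype.subsetPn/negP => TA.
  have := hlocal iA; rewrite leqNgt -FT => /negP; apply.
  have -> : #|T|.+1 = #|j |: T| by rewrite cardsU1 jT.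
  by apply: subset_leq_card; rewrite finset.subsetI jTN finset.subUset finset.sub1set jA TA.
apply: le_trans (yr _ lA); apply: Tmax => //.
by rewrite finset.in_setD jT.
Qed.

Lemma minmax_filter_self y i S S' :
  i \in S -> minmax_filter F y i S S' -> i \in S'.
Proof.
move=> iS [hi [lo [hiP loP ->]]]; rewrite finset.in_setD iS andbT.
apply/finset.bigcupP => -[p _]; rewrite finset.in_setU => /orP[] iT.
- by have [/fintype.subsetP/(_ _ iT)] := hiP p; rewrite !inE eqxx.
- by have [/fintype.subsetP/(_ _ iT)] := loP p; rewrite !inE eqxx.
Qed.

Lemma minmax_filter_sub y i S S' : minmax_filter F y i S S' -> S' \subset S.
Proof. by move=> [hi [lo [_ _ ->]]]; exact: finset.subsetDl. Qed.

(** Every surviving state lies in the ball, and so does their mean. This reduces an update to a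
    subgradient step from a point of the ball. *)
Lemma dmm_update_eball h xhat step y i x' r : i \notin A ->
  dmm_update E F h xhat step y i x' ->
  (forall j, j \notin A -> eball xhat r (y j)) ->
  exists z g, [/\ eball xhat r z, subdiff h z g & x' = z - step *: g].
Proof.
move=> iA [Sd [Sm [g [hd hm hg ->]]]] yr; exists (mean y Sm), g; split=> //.
apply: (mean_eball (minmax_filter_self (dist_filter_self hd) hm)) => j jS.
apply: (dist_filter_eball iA hd yr).
exact: (fintype.subsetP (minmax_filter_sub hm) _ jS).
Qed.

End Filters.

(** * Upper limits and the decrease in one subgradient step *)

Section Convergence.
Context {R : realType} {d : nat}.
Set Implicit Arguments.
Unset Strict Implicit.

(** [limn_esup] is an infimum of suprema over neighbourhoods of infinity, and a tail is one of
    these. *)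
Lemma limn_esup_le (u : nat -> \bar R) (l : \bar R) :
  (\forall k \near \oo, (u k <= l)%E) -> (limn_esup u <= l)%E.
Proof.
move=> [N _ uN]; apply: ge_ereal_inf.
exists (ereal_sup [set u k | k in [set k | (N <= k)%N]]).
  by exists [set k | (N <= k)%N] => //; exact: nbhs_infty_ge.
by apply: ge_ereal_sup => _ [k Nk <-]; exact: uN.
Qed.

(** Expanding the square, the linear term gains at least 2 step c, half of which absorbs the
    quadratic term step^2 |g|^2. *)
Lemma gradient_step (xhat z g : 'rV[R]_d) (c L step B : R) :
  0 <= step -> enorm (z - xhat) ^+ 2 <= B -> enorm g <= L ->
  step * L ^+ 2 <= c -> c <= dot g (z - xhat) ->
  enorm (z - step *: g - xhat) ^+ 2 <= B - step * c.
Proof.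
move=> step0 zB gL sc cg.
have -> : z - step *: g - xhat = (z - xhat) - step *: g by rewrite addrAC.
have : enorm g ^+ 2 <= L ^+ 2.
  by rewrite ler_sqr ?nnegrE ?(le_trans (enorm_ge0 g) gL) ?enorm_ge0.
move: zB; rewrite !enorm_sqr; move: (z - xhat) cg => w cg wB gL2.
rewrite dotDl !dotDr !dotNl !dotNr !dotZl !dotZr (dotC w g).
have := ler_wpM2l step0 cg; have := ler_wpM2l step0 sc.
have := ler_wpM2l (sqr_ge0 step) gL2.
lra.
Qed.

End Convergence.

Theorem theorem2 (R : realType) (d : nat) (V : finType) (E : rel V)
    (A : {set V}) (F : nat)
    (f : V -> 'rV[R]_d -> R) (xhat : 'rV[R]_d) (xstar : V -> 'rV[R]_d)
    (delta theta : V -> R -> R) (eta : nat -> R)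
    (byz : nat -> V -> V -> 'rV[R]_d) (x : nat -> V -> 'rV[R]_d)
    (hd : (0 < d)%N)
    (hreg : exists i, i \notin A)
    (hconvex : forall i,
       convex_function (setT : set (convex_lmodType 'rV[R]_d)) (f i))
    (hargmin : forall i, argmin (f i) !=set0 /\
       exists M : R, argmin (f i) `<=` eball 0 M)
    (hsubgrad : exists2 L : R, 0 < L &
       forall i z g, subdiff (f i) z g -> enorm g <= L)
    (heta_lim : eta @ \oo --> (0 : R))
    (heta_decr : forall k, eta k.+1 < eta k)
    (heta_sum : series eta @ \oo --> +oo)
    (hrobust : robust E ((2 * d + 1) * F + 1))
    (hlocal : F_local E F A)
    (hxstar : forall i, i \notin A -> argmin (f i) (xstar i))
    (hdelta : forall i (eps : R), i \notin A -> 0 < eps -> 0 < delta i eps /\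
       sublevel (f i) (xstar i) eps `<=` eball (xstar i) (delta i eps))
    (htheta : forall i (eps : R), i \notin A -> 0 < eps ->
       0 <= theta i eps < pi / 2 /\
       forall z g, ~ sublevel (f i) (xstar i) eps z -> subdiff (f i) z g ->
         angle (- g) (xstar i - z) <= theta i eps)
    (hdyn : dmm_dynamics E F A f xhat xstar eta byz x) :
  forall i, i \notin A ->
    (limn_esup (fun k => (enorm (x k i - xhat))%:E)
       <= Rstar A xhat xstar delta theta)%E.
Proof.
have [L L0 gL] := hsubgrad.
have eta0 k : 0 <= eta k.
  have /nonincreasing_cvgn_ge/(_ (cvgP _ heta_lim) k) : nonincreasing_seq eta.
    by apply/nonincreasing_seqP => n; exact: ltW.
  by rewrite (cvg_lim _ heta_lim).
move=> i0 i0A; apply: le_ereal_inf_tmp => _ [eps /= eps0 <-].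
set m := \big[maxe/_]_(i | _) _.
have mge i : i \notin A -> ((Num.max (Rtilde xhat xstar i * sec (theta i eps))
    (Rtilde xhat xstar i + delta i eps))%:E <= m)%E.
  by move=> iA; exact: (le_bigmax_cond _ (fun i => (Num.max _ _)%:E)).
(* The bound is trivial for [+oo], and the regular node i0 excludes [-oo]. *)
case: m mge => [M|_|/(_ _ i0A)]; [|by rewrite leey|by []].
move=> mge; apply/lee_addgt0Pr => s s0; rewrite -EFinD.
have M0 : 0 < M.
  have := mge _ i0A; rewrite lee_fin ge_max => /andP[_].
  have [[d0 _] ra] := (hdelta i0 eps i0A eps0, enorm_ge0 (xstar i0 - xhat)).
  by rewrite /Rtilde; lra.
pose rho := M + s / 2.
(* Byzantine nodes get the dummy constant 1, so that a minimum over all of [V] is still positive. *)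
have /choice[cf hcf] i : exists c, 0 < c /\ (i \notin A -> forall z g,
    subdiff (f i) z g -> rho <= enorm (z - xhat) -> c <= dot g (z - xhat)).
  have [iA|iA] := boolP (i \in A); first by exists 1.
  have [[d0 hd0] [ht0 ht]] := (hdelta i eps iA eps0, htheta i eps iA eps0).
  have := mge _ iA; rewrite lee_fin ge_max /Rtilde => /andP[h1 h2].
  have [||c c0 hc] := @subgradient_descent _ _ _ _ xhat _ _ _ rho
    eps0 hd0 d0 ht0 ht.
  - by rewrite /rho; lra.
  - by rewrite /rho; lra.
  - by exists c.
pose c := \big[Num.min/1]_i cf i.
have c0 : 0 < c by apply: lt_bigmin => // i _; have [] := hcf i.
pose bounded k B := forall j, j \notin A -> enorm (x k j - xhat) ^+ 2 <= B.
pose Q := (M + s) ^+ 2.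
have [K _ hK] : \forall k \near \oo, eta k * L <= s / 2 /\ eta k * L ^+ 2 <= c.
  have eL (a b : R) : 0 < a -> 0 < b -> \forall k \near \oo, eta k * a <= b.
    move=> a0 b0; have /cvgrPdist_le/(_ (b / a)) := heta_lim.
    rewrite divr_gt0// => /(_ isT); apply: filterS => k.
    by rewrite sub0r normrN ger0_norm// ler_pdivlMr.
  by apply: filterI; apply: eL; rewrite ?exprn_gt0 ?divr_gt0.
have step k B : (K <= k)%N -> bounded k B ->
    bounded k.+1 (Num.max (B - eta k * c) Q).
  move=> Kk kB j jA; have [etaL etaL2] := hK k Kk.
  have B0 : 0 <= B by apply: le_trans (kB j jA); rewrite sqr_ge0.
  have [z [g [zB zg ->]]] : exists z g,
      [/\ eball xhat (Num.sqrt B) z, subdiff (f j) z g & x k.+1 j = z - eta k *: g].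
    apply: (dmm_update_eball hlocal jA (hdyn.2 k j jA)) => l lA.
    rewrite /eball/= /received (negPf lA).
    by rewrite -[leLHS]ger0_norm ?enorm_ge0// -sqrtr_sqr ler_wsqrtr// kB.
  rewrite le_max; have [zrho|zrho] := leP rho (enorm (z - xhat)).
    apply/orP; left; apply: (@gradient_step _ _ _ _ _ _ L) => //.
    - by rewrite -[leRHS]sqr_sqrtr// ler_sqr ?nnegrE ?enorm_ge0 ?sqrtr_ge0//.
    - exact: gL zg.
    - apply: le_trans ((hcf j).2 jA z g zg zrho).
      exact: bigmin_le.
  apply/orP; right; rewrite ler_sqr ?nnegrE ?enorm_ge0 ?(addr_ge0 (ltW M0) (ltW s0))//.
  rewrite addrAC (le_trans (enormD _ _))// enormN enormZ ger0_norm//.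
  have := ler_wpM2l (eta0 k) (gL _ _ _ zg).
  by move: zrho; rewrite /rho; lra.
(* Arbitrary values at Byzantine nodes can only enlarge this upper bound. *)
pose B0 := \big[Num.max/0]_j enorm (x K j - xhat) ^+ 2.
(* The decreases [eta k * c] telescope into a difference of partial sums; once [Q] is the larger
   term, it remains a valid bound. *)
have iter n :
    bounded (K + n)%N (Num.max (B0 - c * (series eta (K + n)%N - series eta K)) Q).
  elim: n => [|n IH].
    move=> j _; rewrite addn0 subrr mulr0 subr0 le_max; apply/orP; left.
    exact: (le_bigmax _ (fun j => enorm (x K j - xhat) ^+ 2)).
  rewrite addnS => j jA; apply: le_trans (step _ _ (leq_addr _ _) IH j jA) _.
  rewrite seriesSr.
  set S := series eta _; set S' := series eta _.
  have := mulr_ge0 (eta0 (K + n)%N) (ltW c0).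
  rewrite /Num.max; do ![case: ifPn]; lra.
apply: limn_esup_le.
(* Past this threshold the first term of the maximum in [iter] is at most 0, so [Q] is the
   maximum. *)
have /cvgryPge/(_ (B0 / c + series eta K)) := heta_sum.
have := nbhs_infty_ge K.
apply: filterS2 => k Kk sk; rewrite lee_fin.
have := iter (k - K)%N i0 i0A; rewrite subnKC//.
rewrite (max_idPr _); last first.
  apply: le_trans (sqr_ge0 _); rewrite subr_le0 mulrC -ler_pdivrMr//.
  by move: sk; lra.
by rewrite ler_sqr// ?nnegrE ?enorm_ge0 ?(addr_ge0 (ltW M0) (ltW s0)).
Qed.
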